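(* Let $(S,\cdot)$ be an amenable semigroup with unit $\mathbf 1$, equipped with a topology (possibly discrete), let $\mathcal H$ be a complex Hilbert space and let $\rho\colon S\to\mathcal B(\mathcal H)$ be a norm-continuous mapping such that $\rho(st)=\rho(s)\rho(t)$, $\rho(\mathbf 1)=\mathrm{id}_{\mathcal H}$ and $\|\rho(s)\|\le1$ for all $s,t\in S$. Consider the space of $\rho$-Toeplitz operators $$\mathcal T(\rho)=\{C\in\mathcal B(\mathcal H)\mid \rho(s)C\rho(s)^*=C\text{ for all }s\in S\}.$$ Then there exists a completely positive, completely contractive linear mapping $P\colon\mathcal B(\mathcal H)\to\mathcal B(\mathcal H)$ with $\operatorname{Ran}P=\mathcal T(\rho)$, $P\circ P=P$, and $$P(ADB^* )=AP(D)B^*$$ whenever $D\in\mathcal B(\mathcal H)$ and $A,B\in\mathcal B(\mathcal H)$ belong to the commutant of $\rho(S)$.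
   Context: A semigroup $S$ is amenable if, on the space $\mathcal F_b(S)$ of all bounded functions $S\to\mathbb C$ with the sup norm, there is a linear functional $\mu$ with $\|\mu\|=\mu(\mathbf 1)=1$ (here $\mathbf 1$ is the constant function) and $\mu(L_tf)=\mu(f)$ for all $t\in S$ and $f\in\mathcal F_b(S)$, where $(L_tf)(s)=f(ts)$. The commutant of $\rho(S)$ is $\{A\in\mathcal B(\mathcal H)\mid A\rho(s)=\rho(s)A\text{ for all }s\in S\}$. *)

(* Defs.v *)
From HB Require Import structures.
From mathcomp Require Import all_boot all_order all_algebra sesquilinear.
From mathcomp Require Import all_classical all_reals all_analysis.
From mathcomp Require Import complex.

Set Implicit Arguments.
Unset Strict Implicit.
Unset Printing Implicit Defensive.

Import Order.TTheory GRing.Theory Num.Theory.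
Import numFieldNormedType.Exports.

Local Open Scope classical_set_scope.
Local Open Scope ring_scope.

(* The inner product is linear in its first and conjugate-linear in its second
   argument, and induces the norm of the complete normed space H. *)
HB.mixin Record NormedModule_isHilbert (R : realType) H
    of CompleteNormedModule R[i] H := {
  dotp : {dot H for (@Num.conj R[i])};
  dotp_norm : forall x : H, dotp x x = `|x| ^+ 2
}.

#[short(type="hilbertType")]
HB.structure Definition Hilbert (R : realType) :=
  {H of NormedModule_isHilbert R H & CompleteNormedModule R[i] H}.

(* No compatibility between the product and the topology is required. *)
#[short(type="topMonoidType")]
HB.structure Definition TopMonoid := {S of Monoid S & Topological S}.

(* Norms of modules over R[i] take their values in R[i]; this is the same real
   number as an element of R, where suprema are available. *)
Definition rnorm (R : realType) (V : normedZmodType R[i]) (x : V) : R :=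
  complex.Re `|x|.

(* For T bounded. (sup of a set that is not bounded above is 0.) *)
Definition opnorm (R : realType) (U V : Type) (NU : U -> R) (NV : V -> R)
    (T : U -> V) : R :=
  sup [set NV (T x) | x in [set x | NU x <= 1]].

Section BoundedOperators.
Context (R : realType) (H : hilbertType R).

Definition bounded_linear : {pred H -> H} := fun f =>
  `[< linear f /\ exists M : R[i], forall x, `|f x| <= M * `|x| >].

Record bop := Bop { bop_fun :> H -> H; _ : bop_fun \in bounded_linear }.

HB.instance Definition _ := [isSub for bop_fun].
HB.instance Definition _ := [Choice of bop by <:].

Lemma bounded_linear_submod : submod_closed bounded_linear.
Proof.
split.
  apply/asboolP; split=> [a x y|]; first by rewrite /= scaler0 addr0.
  by exists 0 => x; rewrite /= normr0 mul0r.
move=> a f g /asboolP[fl [M fM]] /asboolP[gl [N gN]]; apply/asboolP; split.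
  move=> b x y; rewrite !fctE /= fl gl.
  by rewrite !scalerDr !scalerA (mulrC b) addrACA.
exists (`|a| * M + N) => x; rewrite !fctE.
apply: (le_trans (ler_normD _ _)); rewrite normrZ mulrDl.
by apply: lerD => //; rewrite -mulrA ler_wpM2l.
Qed.

HB.instance Definition _ :=
  GRing.isSubmodClosed.Build R[i] (H -> H) bounded_linear
    bounded_linear_submod.
HB.instance Definition _ := [SubChoice_isSubLmodule of bop by <:].

Lemma bop_linear (A : bop) : linear A.
Proof. by have /asboolP[] := valP A. Qed.

HB.instance Definition _ (A : bop) :=
  GRing.isLinear.Build R[i] H H *:%R A (bop_linear A).

Lemma bop_bounded (A : bop) : exists M : R[i], forall x, `|A x| <= M * `|x|.
Proof. by have /asboolP[] := valP A. Qed.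

Lemma bop_ext (A B : bop) : A =1 B -> A = B.
Proof. by move=> AB; apply/val_inj/funext. Qed.

Fact bop_id_subproof : id \in bounded_linear.
Proof. by apply/asboolP; split=> //; exists 1 => x; rewrite mul1r. Qed.

Fact bop_comp_subproof (A B : bop) : A \o B \in bounded_linear.
Proof.
apply/asboolP; split=> [a x y|]; first by rewrite /= !linearP.
have [M AM] := bop_bounded A; have [N BN] := bop_bounded B.
exists (`|M| * N) => x /=; apply: (le_trans (AM _)).
apply: (@le_trans _ _ (`|M| * `|B x|)).
  have [->|Bx0] := eqVneq (B x) 0; first by rewrite normr0 !mulr0.
  have M0 : 0 <= M by rewrite -(pmulr_lge0 _ (_ : 0 < `|B x|)) ?normr_gt0 ?(le_trans _ (AM _)).
  by rewrite ger0_norm.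
by rewrite -mulrA ler_wpM2l.
Qed.

Definition bop_id : bop := Bop bop_id_subproof.
Definition bop_comp (A B : bop) : bop := Bop (bop_comp_subproof A B).

Fact bop_compA : associative bop_comp. Proof. by move=> A B C; apply: bop_ext. Qed.
Fact bop_comp1l : left_id bop_id bop_comp. Proof. by move=> A; apply: bop_ext. Qed.
Fact bop_comp1r : right_id bop_id bop_comp. Proof. by move=> A; apply: bop_ext. Qed.
Fact bop_compDl : left_distributive bop_comp +%R.
Proof. by move=> A B C; apply: bop_ext. Qed.
Fact bop_compDr : right_distributive bop_comp +%R.
Proof. by move=> A B C; apply: bop_ext => x; exact: raddfD. Qed.

(* The product of B(H) is composition. A trivial H is allowed, so that 1 = 0
   is possible. *)
HB.instance Definition _ := GRing.Zmodule_isPzRing.Build bop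
  bop_compA bop_comp1l bop_comp1r bop_compDl bop_compDr.

Definition bopnorm (A : bop) : R := opnorm (@rnorm R H) (@rnorm R H) A.

(* By the Riesz representation theorem this set is always a singleton. *)
Definition adj (A : bop) : bop :=
  xget 0 [set B : bop | forall x y : H, dotp (A x) y = dotp x (B y)].

End BoundedOperators.

Section CompletelyPositive.
Context (R : realType) (H : hilbertType R).

(* A matrix over B(H) acts on the Hilbert space H^n of column vectors with the
   inner product cvdot; M_n(B(H)) is thereby identified with B(H^n). *)
Definition cvdot n (x y : 'cV[H]_n) : R[i] := \sum_i dotp (x i 0) (y i 0).

Definition cvnorm n (x : 'cV[H]_n) : R := Num.sqrt (complex.Re (cvdot x x)).

Definition mxact n (A : 'M[bop H]_n) (x : 'cV[H]_n) : 'cV[H]_n :=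
  \col_i \sum_j A i j (x j 0).

Definition mxpositive n (A : 'M[bop H]_n) : Prop :=
  forall x : 'cV[H]_n, 0 <= cvdot (mxact A x) x.

Definition mxopnorm n (A : 'M[bop H]_n) : R :=
  opnorm (@cvnorm n) (@cvnorm n) (mxact A).

Definition completely_positive (P : bop H -> bop H) : Prop :=
  forall n (A : 'M[bop H]_n), mxpositive A -> mxpositive (map_mx P A).

Definition completely_contractive (P : bop H -> bop H) : Prop :=
  forall n (A : 'M[bop H]_n), mxopnorm (map_mx P A) <= mxopnorm A.

End CompletelyPositive.

Section Amenable.
Context (R : realType).

Definition bounded_complex (S : Type) : {pred S -> R[i]} := fun f =>
  `[< exists M : R[i], forall s, `|f s| <= M >].

Section BoundedFunctions.
Context (S : Type).

Record bfun := Bfun { bfun_fun :> S -> R[i]; _ : bfun_fun \in @bounded_complex S }.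

HB.instance Definition _ := [isSub for bfun_fun].
HB.instance Definition _ := [Choice of bfun by <:].

Lemma bounded_complex_submod : submod_closed (@bounded_complex S).
Proof.
split; first by apply/asboolP; exists 0 => s; rewrite /= normr0.
move=> a f g /asboolP[M fM] /asboolP[N gN]; apply/asboolP.
exists (`|a| * M + N) => s; rewrite !fctE.
apply: (le_trans (ler_normD _ _)); rewrite -[X in `|X| + _]/(a * f s) normrM.
by apply: lerD => //; rewrite ler_wpM2l.
Qed.

HB.instance Definition _ :=
  GRing.isSubmodClosed.Build R[i] (S -> R[i]) (@bounded_complex S)
    bounded_complex_submod.
HB.instance Definition _ := [SubChoice_isSubLmodule of bfun by <:].

Fact bfun_one_subproof : (fun _ : S => 1) \in @bounded_complex S.
Proof. by apply/asboolP; exists 1 => s; rewrite normr1. Qed.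

Definition bfun_one : bfun := Bfun bfun_one_subproof.

Definition supnorm (f : bfun) : R := sup [set rnorm (f s) | s in setT].

End BoundedFunctions.

Fact ltranslate_subproof (S : semigroupType) (t : S) (f : bfun S) :
  (fun s => f (t * s)%g) \in @bounded_complex S.
Proof.
have /asboolP[M fM] := valP f.
by apply/asboolP; exists M => s; exact: fM.
Qed.

Definition ltranslate (S : semigroupType) (t : S) (f : bfun S) : bfun S :=
  Bfun (ltranslate_subproof t f).

Definition amenable (S : semigroupType) : Prop :=
  exists mu : {scalar bfun S},
    [/\ opnorm (@supnorm S) (@rnorm R R[i]) mu = 1,
        mu (bfun_one S) = 1
      & forall t f, mu (ltranslate t f) = mu f].

End Amenable.

Section Toeplitz.
Context (R : realType) (H : hilbertType R).

Definition commutant (S : Type) (rho : S -> bop H) : set (bop H) :=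
  [set A | forall s, A * rho s = rho s * A].

Definition opnorm_continuous (S : topologicalType) (rho : S -> bop H) : Prop :=
  forall s : S, bopnorm (rho t - rho s) @[t --> s] --> (0 : R).

Definition toeplitz (S : Type) (rho : S -> bop H) : set (bop H) :=
  [set C | forall s, rho s * C * adj (rho s) = C].

End Toeplitz.

(* Main.v *)
(* An invariant mean mu on S averages the operators rho s * D * (rho s)^*: the
   bounded sesquilinear form (x, y) |-> mu (s |-> <rho s D (rho s)^* x, y>) is
   <P D x, y> for a unique operator P D, by the Riesz representation theorem.
   Left invariance of mu makes P D a Toeplitz operator, mu 1 = 1 makes P fix
   Toeplitz operators, and A, B^* can be pulled out of the average when A and B
   commute with rho. Since ||mu|| = mu 1 = 1, mu is positive and bounded by the
   sup norm; applied to s |-> <A (rho s)^* x, (rho s)^* y> on columns x, y,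
   this gives complete positivity and complete contractivity. *)
From HB Require Import structures.
From mathcomp Require Import all_boot all_order all_algebra sesquilinear.
From mathcomp Require Import all_classical all_reals all_analysis.
From mathcomp Require Import complex ring lra.
Require Import Defs.

Set Implicit Arguments.
Unset Strict Implicit.
Unset Printing Implicit Defensive.

Import Order.TTheory GRing.Theory Num.Theory.
Import numFieldNormedType.Exports.

Local Open Scope classical_set_scope.
Local Open Scope ring_scope.

(** * Inner products over a closed field: Cauchy-Schwarz and separation of points *)

Section DotForms.
Variables (C : numClosedFieldType) (U : lmodType C).
Variable form : {dot U for (@Num.conj C)}.

(** Expand the square of [u - a *: v], which is nonnegative for every [a], at the orthogonal
    projection coefficient [a = form u v / form v v]. *)
Lemma dot_CauchySchwarz (u v : U) :
  `|form u v| ^+ 2 <= form u u * form v v.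
Proof.
have [->|v0] := eqVneq v 0.
  by rewrite !linear0r normr0 expr0n.
have vv0 : 0 < form v v by rewrite dnorm_gt0.
have w0 : form v v != 0 by rewrite gt_eqF.
have key a : 0 <= form u u + a * a^*%R * form v v -
    (a^*%R * form u v + a * (form u v)^*%R).
  have := dnorm_ge0 form (u - a *: v).
  by rewrite dnormB dnormZ linearZr_LR /= rmorphM /= conjCK normCK.
have := key (form u v / form v v).
have -> : (form u v / form v v)^*%R = (form u v)^*%R / form v v.
  by rewrite rmorphM fmorphV /= (conj_Creal (gtr0_real vv0)).
rewrite normCK; set d := form u v; set e := d^*%R; set w := form v v => h.
rewrite -ler_pdivrMr// -subr_ge0 (le_trans h)// le_eqVlt; apply/predU1P; left.
by field.
Qed.

Lemma dot_injl (u v : U) : (forall w, form u w = form v w) -> u = v.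
Proof.
move=> uv; apply/eqP; rewrite -subr_eq0 -(dnorm_eq0 form) linearBl /=.
by rewrite uv subrr.
Qed.

End DotForms.

(** * Real-valued norms over [R[i]] and operator norms as suprema *)

Section ComplexNorm.
Local Open Scope complex_scope.
Variable R : realType.

Lemma rnormE (V : normedZmodType R[i]) (x : V) : (rnorm x)%:C = `|x|.
Proof. by rewrite RRe_real// normr_real. Qed.

Lemma rnorm_ge0 (V : normedZmodType R[i]) (x : V) : 0 <= rnorm x.
Proof. by rewrite -ler0c rnormE. Qed.

Lemma rnorm_le (V : normedZmodType R[i]) (x : V) M : (rnorm x <= M) = (`|x| <= M%:C).
Proof. by rewrite -rnormE lecR. Qed.

Lemma Re_le_rnorm (z : R[i]) : `|complex.Re z| <= rnorm z.
Proof. by rewrite -lecR rnormE normc_ge_Re. Qed.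

Lemma rnormZ (V : normedModType R[i]) (a : R) (x : V) :
  0 <= a -> rnorm (a%:C *: x) = a * rnorm x.
Proof.
move=> a0; apply: complexI; rewrite rmorphM /= !rnormE normrZ ger0_norm//.
by rewrite ler0c.
Qed.

Lemma rnorm_eq0 (V : normedZmodType R[i]) (x : V) : rnorm x = 0 -> x = 0.
Proof. by move=> x0; apply/eqP; rewrite -normr_eq0 -rnormE x0. Qed.

Lemma rnormZr (a : R) (z : R[i]) : 0 <= a -> rnorm (a%:C * z) = a * rnorm z.
Proof.
move=> a0; apply: complexI; rewrite rmorphM /= !rnormE normrM ger0_norm//.
by rewrite ler0c.
Qed.

Lemma rnorm_sum (V : normedZmodType R[i]) I (r : seq I) (F : I -> V) :
  rnorm (\sum_(i <- r) F i) <= \sum_(i <- r) rnorm (F i).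
Proof.
rewrite -lecR rnormE rmorph_sum (le_trans (ler_norm_sum _ _ _))//.
by apply: ler_sum => i _; rewrite -rnormE.
Qed.

(** A bound [M] is an arbitrary complex number. For [y != 0] the inequality forces it to be real and
    nonnegative; for [y = 0] both bounds are 0. *)
Lemma norm_bound_norm (M : R[i]) (V W : normedZmodType R[i]) (x : V) (y : W) :
  `|x| <= M * `|y| -> `|x| <= `|M| * `|y|.
Proof.
have [->|y0] := eqVneq y 0; first by rewrite !normr0 !mulr0.
have yp : 0 < `|y| by rewrite normr_gt0.
move=> xy; have M0 : 0 <= M by rewrite -(pmulr_lge0 _ yp) (le_trans _ xy).
by rewrite ger0_norm.
Qed.

(* The boundedness hypothesis excludes the junk value of sup. *)
Lemma opnorm_bound (U V : Type) (NU : U -> R) (NV : V -> R) (T : U -> V) :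
  (forall x, 0 <= NU x) -> (forall x, NU x = 0 -> NV (T x) = 0) ->
  (forall (a : R) x, 0 <= a ->
    exists2 y, NU y = a * NU x & NV (T y) = a * NV (T x)) ->
  has_ubound [set NV (T x) | x in [set x | NU x <= 1]] ->
  forall x, NV (T x) <= opnorm NU NV T * NU x.
Proof.
move=> NU0 NUeq0 NZ ub x.
have [x0|x0] := eqVneq (NU x) 0; first by rewrite x0 NUeq0// mulr0.
have xp : 0 < NU x by rewrite lt_neqAle eq_sym x0 NU0.
have [|y yx Tyx] := NZ (NU x)^-1 x; first by rewrite invr_ge0.
rewrite -ler_pdivrMr// mulrC -Tyx.
by apply: ub_le_sup => //; exists y => //=; rewrite yx mulVf.
Qed.

Lemma opnorm_ge0 (U V : Type) (NU : U -> R) (NV : V -> R) (T : U -> V) :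
  (forall x, 0 <= NV x) -> 0 <= opnorm NU NV T.
Proof.
move=> NV0; rewrite /opnorm; set E := [set _ | _ in _].
have [supE|/sup_out ->//] := pselect (has_sup E).
have [[y Ey] ub] := supE; have [x _ xy] := Ey.
by rewrite (le_trans _ (ub_le_sup ub Ey))// -xy.
Qed.

End ComplexNorm.

(** * Cauchy-Schwarz and the norm of a sum in a Hilbert space *)

Section Hilbert.
Local Open Scope complex_scope.
Variables (R : realType) (H : hilbertType R).
Implicit Types x y : H.

Lemma dotpC x y : dotp x y = (dotp y x)^*%R.
Proof. by rewrite hermC mul1r. Qed.

Lemma rnorm_dotp x y : rnorm (dotp x y) <= rnorm x * rnorm y.
Proof.
rewrite -lecR rmorphM /= !rnormE -ler_sqr ?nnegrE ?mulr_ge0//.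
by rewrite exprMn -!dotp_norm dot_CauchySchwarz.
Qed.

Lemma rnormD_sqr x y :
  rnorm (x + y) ^+ 2 = rnorm x ^+ 2 + rnorm y ^+ 2 + 2 * complex.Re (dotp x y).
Proof.
apply: complexI; rewrite !(rmorphXn, rmorphD, rmorphM) /= !rnormE.
rewrite -!dotp_norm dnormD; congr (_ + _).
exact: addcJ.
Qed.

End Hilbert.

(** * The Riesz representation theorem by minimisation *)

Section Riesz.
Local Open Scope complex_scope.
Variables (R : realType) (H : hilbertType R) (phi : H -> R[i]) (M : R).
Hypothesis phiP : forall a x y, phi (a *: x + y) = a * phi x + phi y.
Hypothesis phi_bound : forall x, rnorm (phi x) <= M * rnorm x.

(* A minimiser of the energy represents phi; minimising sequences are Cauchy by
   the parallelogram identity. *)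
Let energy (x : H) : R := rnorm x ^+ 2 - 2 * complex.Re (phi x).

(** Half the directional derivative of [energy] at [z] along [h]; it vanishes for all [h] exactly
    when [z] represents the real part of [phi]. *)
Let defect (z h : H) : R := complex.Re (dotp h z - phi h).

Let phiD x y : phi (x + y) = phi x + phi y.
Proof. by have := phiP 1 x y; rewrite scale1r mul1r. Qed.

Let phi0 : phi 0 = 0.
Proof. by apply: (addrI (phi 0)); rewrite -phiD !addr0. Qed.

Let phiZ a x : phi (a *: x) = a * phi x.
Proof. by have := phiP a x 0; rewrite phi0 !addr0. Qed.

Let phiN x : phi (- x) = - phi x.
Proof. by rewrite -scaleN1r phiZ mulN1r. Qed.

Let energyD x h : energy (x + h) = energy x + (rnorm h ^+ 2 + 2 * defect x h).
Proof.
rewrite /energy /defect [x + h]addrC rnormD_sqr phiD !raddfD /= raddfN /=.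
by ring.
Qed.

Let energy_ge x : - M ^+ 2 <= energy x.
Proof.
rewrite /energy.
have := ler_norm (complex.Re (phi x)).
have := Re_le_rnorm (phi x).
have := phi_bound x.
move: (rnorm x) (complex.Re _) => r c h1 h2 h3.
have : 0 <= (r - M) ^+ 2 by exact: sqr_ge0.
nra.
Qed.

Let defectN z h : defect z (- h) = - defect z h.
Proof. by rewrite /defect phiN linearNl -opprD raddfN. Qed.

Let defectZ z (a : R) h : defect z (a%:C *: h) = a * defect z h.
Proof.
rewrite /defect phiZ linearZl_LR /= -mulrBr; case: (dotp h z - _) => u v /=.
by rewrite mul0r subr0.
Qed.

(** Expand the energy at the midpoint [w] along [h] and [- h]: in the sum the defects cancel, and
    [m <= energy w] leaves only the square of [h]. *)
Let minimizing_dist m e x y : (forall w, m <= energy w) ->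
  energy x < m + e -> energy y < m + e -> rnorm (x - y) ^+ 2 <= 4 * e.
Proof.
move=> mP xe ye.
pose w := (2^-1 : R)%:C *: (x + y); pose h := (2^-1 : R)%:C *: (x - y).
have half (u : H) : (2^-1 : R)%:C *: u + (2^-1 : R)%:C *: u = u.
  by rewrite -scalerDl -rmorphD (_ : _ + _ = 1) ?scale1r//; field.
have xE : x = w + h by rewrite -scalerDr addrACA subrr addr0 scalerDr half.
have yE : y = w - h.
  by rewrite -scalerBr opprB [x + y + _]addrC addrA subrK scalerDr half.
have hE : rnorm (x - y) ^+ 2 = 4 * rnorm h ^+ 2.
  by rewrite /h rnormZ ?invr_ge0//; field.
move: xe ye; rewrite hE {1}xE {1}yE !energyD defectN.
rewrite (_ : rnorm (- h) = rnorm h); last by rewrite /rnorm normrN.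
by have := mP w; lra.
Qed.

(** Along a negative defect a short step makes the linear term beat the quadratic one. Since the
    defect is odd in [h], nonnegativity suffices. *)
Let defect_eq0 z : (forall h, 0 <= rnorm h ^+ 2 + 2 * defect z h) ->
  forall h, defect z h = 0.
Proof.
move=> zP.
suff ge0 h : 0 <= defect z h.
  by move=> h; apply/eqP; rewrite eq_le ge0 -oppr_ge0 -defectN ge0.
rewrite leNgt; apply/negP => c0.
set r := rnorm h; set c := defect z h in c0.
have r0 : 0 < 1 + r ^+ 2 by rewrite ltr_pwDl// sqr_ge0.
(* With this [t] the expression at [t%:C *: h] is [t ^+ 2 * r ^+ 2 - 2 * t ^+ 2 * (1 + r ^+ 2)],
   which is negative. *)
pose t := - c / (1 + r ^+ 2).
have t0 : 0 < t by rewrite divr_gt0// oppr_gt0.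
have tr : t * (1 + r ^+ 2) = - c by rewrite /t divfK// gt_eqF.
have := zP (t%:C *: h); rewrite rnormZ ?(ltW t0)// defectZ -/r -/c.
by clearbody t r c; nra.
Qed.

Lemma Riesz_representation : exists z, forall x, phi x = dotp x z.
Proof.
pose E := range energy.
have Einf : has_inf E.
  split; first by exists (energy 0), 0.
  by exists (- M ^+ 2) => _ [x _ <-]; exact: energy_ge.
pose m := inf E.
have mP w : m <= energy w by apply: ge_inf; [exact: Einf.2|exists w].
have [x_ x_P] : {x_ : nat -> H & forall n, energy (x_ n) < m + n.+1%:R^-1}.
  apply: (@choice _ _ (fun n x => energy x < m + n.+1%:R^-1)) => n.
  have [|_ [x _ <-] xm] := @inf_adherent _ E (n.+1%:R^-1) _ Einf.
    by rewrite invr_gt0.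
  by exists x.
have cvgx : cvg (x_ @ \oo).
  apply: cauchy_cvg; apply: cauchy_exP => eps eps0.
  have e0 : 0 < complex.Re eps by move: eps0; rewrite ltcE => /andP[].
  have epsE : eps = (complex.Re eps)%:C by rewrite RRe_real// gtr0_real.
  move: (complex.Re eps) e0 epsE => e e0 ->.
  (* From index [N] on, [minimizing_dist] bounds squared distances by [4 * N.+1%:R^-1], which has to
     be less than [e ^+ 2]. *)
  have e20 : 0 < e ^+ 2 / 4 by rewrite divr_gt0// exprn_gt0.
  have [N _ NP] := near_infty_natSinv_lt (PosNum e20).
  exists (x_ N), N => // n /= Nn.
  rewrite -ball_normE /= -rnormE ltcR -(@ltr_pXn2r _ 2)// ?nnegrE ?rnorm_ge0 ?ltW//.
  apply: (@le_lt_trans _ _ (4 * N.+1%:R^-1)).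
    apply: minimizing_dist mP _ _ => //; rewrite (lt_le_trans (x_P _))// lerD2l.
    by rewrite lef_pV2 ?posrE// ler_nat.
  have : N.+1%:R^-1 < e ^+ 2 / 4 := NP N (leqnn N).
  move: (N.+1%:R^-1 : R) => u; lra.
pose z := lim (x_ @ \oo).
exists z.
have approx (e : R) : 0 < e -> exists n, n.+1%:R^-1 < e /\ rnorm (z - x_ n) < e.
  move=> e0.
  have [N _ NP] := near_infty_natSinv_lt (PosNum e0).
  have ec0 : 0 < e%:C by rewrite ltcR.
  have /cvgrPdist_lt /(_ _ ec0)[N' _ N'P] : x_ @ \oo --> z := cvgx.
  exists (maxn N N'); split; first by apply: (NP _); rewrite /= leq_maxl.
  by rewrite -ltcR rnormE; apply: (N'P _); rewrite /= leq_maxr.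
have Rez : forall h, defect z h = 0.
  apply: defect_eq0 => h; rewrite leNgt; apply/negP => c0.
  set c := (X in X < 0) in c0.
  have r0 : 0 < 1 + 2 * rnorm h by have := rnorm_ge0 h; lra.
  (* Replacing [z] by [x_ n] costs less than [e] in the energy and at most [2 * rnorm h * e] in the
     defect term. The total stays within [- c / 2], so [energy (x_ n + h)] would fall below the
     infimum. *)
  pose e : R := - c / (1 + 2 * rnorm h) / 2.
  have e0 : 0 < e by rewrite divr_gt0// divr_gt0// oppr_gt0.
  have er : e * (1 + 2 * rnorm h) = - c / 2.
    by rewrite /e mulrAC divfK// gt_eqF.
  have [n [ne xn]] := approx e e0.
  have := mP (x_ n + h); rewrite energyD.
  have -> : defect (x_ n) h = defect z h - complex.Re (dotp h (z - x_ n)).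
    by rewrite /defect linearBr /= !raddfB /=; ring.
  have := Re_le_rnorm (dotp h (z - x_ n)).
  rewrite ler_norml => /andP[q1 _].
  have q2 := rnorm_dotp h (z - x_ n).
  have := ler_wpM2l (rnorm_ge0 h) (ltW xn).
  have := x_P n; rewrite /c in er c0.
  move: q1 q2 ne er c0; clearbody e; rewrite mulrDr mulr1 mulrCA.
  rewrite (mulrC (rnorm h) e).
  move: (complex.Re (dotp h (z - _))) (n.+1%:R^-1 : R) (e * rnorm h) => *; lra.
move=> x; apply/eqP; rewrite eq_sym -subr_eq0; apply/eqP.
(* The defect only sees real parts; evaluating it at ['i *: x] recovers the imaginary part. *)
have := Rez x; have := Rez ('i *: x).
rewrite /defect phiZ linearZl_LR /= -mulrBr.
case: (dotp x z - phi x) => u v /=; rewrite mul0r mul1r sub0r.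
by move=> /eqP; rewrite oppr_eq0 => /eqP -> ->.
Qed.

End Riesz.

(** * Bounded operators, sesquilinear forms and adjoints *)

Section Operators.
Local Open Scope complex_scope.
Variables (R : realType) (H : hilbertType R).
Implicit Types (x y : H) (A B : bop H).

Lemma bopnorm_bound A x : rnorm (A x) <= bopnorm A * rnorm x.
Proof.
apply: (opnorm_bound (@rnorm_ge0 _ _)) => [y|a y a0|].
- by move=> /rnorm_eq0 ->; rewrite linear0 /rnorm normr0.
- by exists (a%:C *: y); rewrite ?linearZ rnormZ.
have [M AM] := bop_bounded A; exists (rnorm M) => _ [y /= y1 <-].
rewrite rnorm_le (le_trans (norm_bound_norm (AM y)))// -!rnormE -rmorphM lecR.
by rewrite ler_piMr// rnorm_ge0.
Qed.

Lemma bopnorm_ge0 A : 0 <= bopnorm A.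
Proof. by apply: opnorm_ge0 => x; exact: rnorm_ge0. Qed.

(** For fixed [x] the conjugate of [b x] is a bounded linear functional, so Riesz supplies [B x];
    uniqueness of the representing vector makes [B] linear. *)
Lemma bop_of_form (b : H -> H -> R[i]) (M : R) :
    (forall a x x' y, b (a *: x + x') y = a * b x y + b x' y) ->
    (forall a x y y', b x (a *: y + y') = a^*%R * b x y + b x y') ->
    (forall x y, rnorm (b x y) <= M * rnorm x * rnorm y) ->
  exists B : bop H, forall x y, dotp (B x) y = b x y.
Proof.
move=> bl br bM.
have [B BP] : {B : H -> H & forall x y, dotp (B x) y = b x y}.
  apply: (@choice _ _ (fun x z => forall y, dotp z y = b x y)) => x.
  have [|y|z zP] := @Riesz_representation R H (fun y => (b x y)^*%R) (M * rnorm x).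
  - by move=> a y y'; rewrite br rmorphD rmorphM /= conjCK.
  - by apply: le_trans (bM x y); rewrite rnorm_le rnormE norm_conjC.
  by exists z => y; rewrite dotpC -zP conjCK.
have Bb : B \in @bounded_linear R H.
  apply/asboolP; split.
    move=> a x x'; apply: (dot_injl (form := @dotp R H)) => w.
    by rewrite BP bl -!BP linearDl /= linearZl_LR.
  (* No sign is assumed on [M]. The bound comes from testing the form at [y = B x] and cancelling
     one factor [rnorm (B x)]. *)
  exists `|M|%:C => x; rewrite -!rnormE -rmorphM lecR.
  have [->|Bx0] := eqVneq (B x) 0.
    by rewrite {1}/rnorm normr0 mulr_ge0 ?rnorm_ge0.
  have Bp : 0 < rnorm (B x) by rewrite -ltcR rnormE normr_gt0.
  rewrite -(ler_pM2r Bp) (@le_trans _ _ (M * rnorm x * rnorm (B x)))//; last first.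
    by rewrite !ler_wpM2r ?rnorm_ge0 ?ler_norm.
  rewrite (le_trans _ (bM _ _))// -BP -lecR rmorphM /= !rnormE.
  by rewrite dotp_norm normrX normr_id.
by exists (Bop Bb).
Qed.

(** The default value of [xget] never occurs: the bounded form [dotp y (A x)] in [y] and [x] is
    represented by an operator, which is an adjoint. *)
Lemma adjP A x y : dotp (A x) y = dotp x (adj A y).
Proof.
rewrite /adj; case: xgetP => [B _ ->//|no].
have [|||B BP] := @bop_of_form (fun y x => dotp y (A x)) (bopnorm A).
- by move=> a y1 y2 z; rewrite linearDl /= linearZl_LR.
- by move=> a y1 z z'; rewrite linearP linearDr /= linearZr_LR.
- move=> u v; rewrite (le_trans (rnorm_dotp _ _))// mulrC mulrAC.
  by rewrite ler_wpM2r ?rnorm_ge0// bopnorm_bound.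
by case: (no B) => u v; rewrite dotpC -BP -dotpC.
Qed.

Lemma adjPl A x y : dotp (adj A x) y = dotp x (A y).
Proof. by rewrite dotpC -adjP -dotpC. Qed.

Lemma bop_dot_inj A B : (forall x y, dotp (A x) y = dotp (B x) y) -> A = B.
Proof. by move=> AB; apply: bop_ext => x; exact: dot_injl. Qed.

Lemma adjM A B : adj (A * B) = adj B * adj A.
Proof.
by apply: bop_dot_inj => x y; rewrite adjPl [RHS]adjPl adjPl.
Qed.

(** The squared norm of [adj A x] equals [dotp (A (adj A x)) x]; apply Cauchy-Schwarz and divide by
    the norm of [adj A x]. *)
Lemma adj_contractive A : bopnorm A <= 1 -> forall x, rnorm (adj A x) <= rnorm x.
Proof.
move=> A1 x; have [->|Bx0] := eqVneq (adj A x) 0.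
  by rewrite /rnorm normr0 rnorm_ge0.
have Bp : 0 < rnorm (adj A x) by rewrite -ltcR rnormE normr_gt0.
rewrite -(ler_pM2r Bp) mulrC.
have -> : rnorm (adj A x) * rnorm (adj A x) = rnorm (dotp (A (adj A x)) x).
  rewrite adjP; apply: complexI; rewrite rmorphM /= !rnormE dotp_norm.
  by rewrite normrX normr_id.
rewrite (le_trans (rnorm_dotp _ _))// mulrC ler_wpM2l ?rnorm_ge0//.
by rewrite (le_trans (bopnorm_bound _ _))// ler_piMl ?rnorm_ge0.
Qed.

End Operators.

(** * Norms of column vectors and of operator matrices *)

Section ColumnVectors.
Local Open Scope complex_scope.
Variables (R : realType) (H : hilbertType R) (n : nat).
Implicit Types (x y : 'cV[H]_n) (A : 'M[bop H]_n).

Lemma cvdot_ge0 x : 0 <= cvdot x x.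
Proof. by apply: sumr_ge0 => i _; exact: dnorm_ge0. Qed.

Lemma cvnormE x : cvnorm x = Num.sqrt (\sum_i rnorm (x i 0) ^+ 2).
Proof.
rewrite /cvnorm; congr Num.sqrt; apply: complexI.
rewrite RRe_real; last by rewrite ger0_real// cvdot_ge0.
by rewrite rmorph_sum; apply: eq_bigr => i _; rewrite dotp_norm rmorphXn /= rnormE.
Qed.

Lemma cvnorm_ge0 x : 0 <= cvnorm x.
Proof. exact: sqrtr_ge0. Qed.

Lemma cvnorm_sqr x : cvnorm x ^+ 2 = \sum_i rnorm (x i 0) ^+ 2.
Proof.
by rewrite cvnormE sqr_sqrtr// sumr_ge0// => i _; exact: sqr_ge0.
Qed.

Lemma cvdotxx x : cvdot x x = (cvnorm x ^+ 2)%:C.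
Proof.
rewrite cvnorm_sqr rmorph_sum; apply: eq_bigr => i _.
by rewrite dotp_norm rmorphXn /= rnormE.
Qed.

Lemma rnorm_le_cvnorm x i : rnorm (x i 0) <= cvnorm x.
Proof.
rewrite cvnormE -[leLHS]ger0_norm ?rnorm_ge0// -sqrtr_sqr ler_wsqrtr//.
by rewrite (bigD1 i)//= lerDl sumr_ge0// => j _; exact: sqr_ge0.
Qed.

Lemma cvnorm_eq0 x : cvnorm x = 0 -> x = 0.
Proof.
move=> x0; apply/matrixP => i j; rewrite ord1 mxE; apply: rnorm_eq0.
by apply/eqP; rewrite eq_le rnorm_ge0 -x0 rnorm_le_cvnorm.
Qed.

Lemma cvnormZ (a : R) x :
  0 <= a -> cvnorm (map_mx ( *:%R a%:C) x) = a * cvnorm x.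
Proof.
move=> a0; rewrite !cvnormE -[a in RHS]ger0_norm// -sqrtr_sqr -sqrtrM ?sqr_ge0//.
congr Num.sqrt; rewrite mulr_sumr; apply: eq_bigr => i _.
by rewrite mxE rnormZ// exprMn.
Qed.

Lemma rnorm_cvdot x y : rnorm (cvdot x y) <= cvnorm x * cvnorm y.
Proof.
have [x0|x0] := eqVneq (cvnorm x) 0.
  rewrite x0 (cvnorm_eq0 x0) mul0r /cvdot big1 /rnorm ?normr0// => i _.
  by rewrite mxE linear0l.
have [y0|y0] := eqVneq (cvnorm y) 0.
  rewrite y0 (cvnorm_eq0 y0) mulr0 /cvdot big1 /rnorm ?normr0// => i _.
  by rewrite mxE linear0r.
set a := cvnorm x in x0 *; set b := cvnorm y in y0 *.
have a0 : 0 < a by rewrite lt_neqAle eq_sym x0 cvnorm_ge0.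
have b0 : 0 < b by rewrite lt_neqAle eq_sym y0 cvnorm_ge0.
rewrite (le_trans (rnorm_sum _ _))//.
(* AM-GM: [2 a b r s <= b^2 r^2 + a^2 s^2] *)
apply: (@le_trans _ _ (\sum_i (b / a / 2 * rnorm (x i 0) ^+ 2 +
                               a / b / 2 * rnorm (y i 0) ^+ 2))).
  apply: ler_sum => i _; rewrite (le_trans (rnorm_dotp _ _))//.
  move: (rnorm (x i 0)) (rnorm (y i 0)) => r s; rewrite -subr_ge0.
  have -> : b / a / 2 * r ^+ 2 + a / b / 2 * s ^+ 2 - r * s =
      (b * r - a * s) ^+ 2 / (2 * a * b) by field; rewrite y0 x0.
  by rewrite divr_ge0 ?sqr_ge0// !mulr_ge0// ltW.
rewrite big_split /= -!mulr_sumr -!cvnorm_sqr -/a -/b le_eqVlt; apply/predU1P.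
by left; field; rewrite y0 x0.
Qed.

Lemma mxopnorm_ge0 A : 0 <= mxopnorm A.
Proof. by apply: opnorm_ge0 => x; exact: cvnorm_ge0. Qed.

Lemma mxopnorm_bound A x : cvnorm (mxact A x) <= mxopnorm A * cvnorm x.
Proof.
apply: (opnorm_bound cvnorm_ge0) => [y y0|a y a0|].
- rewrite (cvnorm_eq0 y0) (_ : mxact A 0 = 0) ?cvnormE; last first.
    apply/matrixP => i j; rewrite !mxE big1// => k _.
    by rewrite mxE linear0.
  by rewrite big1 ?sqrtr0// => i _; rewrite mxE /rnorm normr0 expr0n.
- exists (map_mx ( *:%R a%:C) y); rewrite -cvnormZ//; congr cvnorm.
  apply/matrixP => i j; rewrite !mxE scaler_sumr.
  by apply: eq_bigr => k _; rewrite mxE linearZ.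
(* On the unit ball every entry of [y] has norm at most 1, so the triangle inequality bounds row [i]
   by the sum of the norms of its entries. *)
exists (Num.sqrt (\sum_i (\sum_j bopnorm (A i j)) ^+ 2)) => _ [y /= y1 <-].
rewrite cvnormE ler_wsqrtr// ler_sum// => i _.
rewrite ler_sqr ?nnegrE ?rnorm_ge0//; last first.
  by rewrite sumr_ge0// => j _; exact: bopnorm_ge0.
rewrite mxE (le_trans (rnorm_sum _ _))// ler_sum// => j _.
rewrite (le_trans (bopnorm_bound _ _))// ler_piMr ?bopnorm_ge0//.
exact: le_trans (rnorm_le_cvnorm _ _) y1.
Qed.

End ColumnVectors.

(** * Means of bounded functions: linearity, norm bound, positivity *)

Section Mean.
Local Open Scope complex_scope.
Variables (R : realType) (S : Type) (s0 : S) (mu : {scalar bfun R S}).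
Hypothesis mu_opnorm : opnorm (@supnorm R S) (@rnorm R R[i]) mu = 1.
Hypothesis mu_one : mu (bfun_one R S) = 1.
Implicit Types f g : S -> R[i].

(* mean f is 0 for f unbounded. *)
Definition mean f : R[i] := mu (insubd 0 f).

Lemma bounded_complexP f (M : R) : (forall s, rnorm (f s) <= M) ->
  f \in @bounded_complex R S.
Proof. by move=> fM; apply/asboolP; exists M%:C => s; rewrite -rnorm_le. Qed.

Lemma meanP a f g : f \in @bounded_complex R S -> g \in @bounded_complex R S ->
  mean (fun s => a * f s + g s) = a * mean f + mean g.
Proof.
move=> fb gb; rewrite /mean -linearP; congr (mu _); apply: val_inj.
rewrite /= !insubdK//.
have : a *: f + g \in @bounded_complex R S by rewrite rpredD// rpredZ.
exact.
Qed.

Lemma mean_cst c : mean (fun=> c) = c.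
Proof.
rewrite -[RHS]mulr1 -mu_one -linearZ; congr (mu _); apply: val_inj.
rewrite insubdK; last by apply: (@bounded_complexP _ (rnorm c)).
by apply/funext => s /=; rewrite -[RHS]/(c * 1) mulr1.
Qed.

Lemma mean_sum (I : finType) (F : I -> S -> R[i]) :
  (forall i, F i \in @bounded_complex R S) ->
  mean (fun s => \sum_i F i s) = \sum_i mean (F i).
Proof.
move=> Fb; rewrite /mean -linear_sum; congr (mu _); apply: val_inj.
have -> : (fun s => \sum_i F i s) = \sum_i F i.
  by apply/funext => s; rewrite fct_sumE.
rewrite insubdK ?rpred_sum// raddf_sum /=.
by apply: eq_bigr => i _; rewrite insubdK.
Qed.

Lemma rnorm_mean f (M : R) : (forall s, rnorm (f s) <= M) -> rnorm (mean f) <= M.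
Proof.
move=> fM.
(* As [sup] is 0 where no supremum exists, operator norm 1 forces the values on the unit ball to be
   bounded. *)
have [ub|/sup_out noub] := pselect (has_sup
    [set rnorm (mu g) | g in [set g | supnorm g <= 1]]); last first.
  by move: mu_opnorm => /eqP; rewrite /opnorm noub eq_sym oner_eq0.
have M0 : 0 <= M by exact: le_trans (rnorm_ge0 _) (fM s0).
(* The slack [e] allows [M = 0]: dividing [f] by [M + e] always lands in the unit ball. *)
apply/ler_addgt0Pr => e e0; have Me0 : 0 < M + e by rewrite ltr_wpDl.
have fb := bounded_complexP fM.
pose g := ((M + e)^-1)%:C *: insubd 0 f : bfun R S.
rewrite -[M + e]mulr1 -ler_pdivrMl// -rnormZr ?invr_ge0 ?(ltW Me0)// -mu_opnorm.
rewrite -[_ * mean f]linearZ.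
apply: ub_le_sup; first exact: ub.2.
exists g => //=; apply: ge_sup; first by exists (rnorm (g s0)), s0.
move=> _ [s _ <-]; rewrite /g /= insubdK// -[_ s]/(_%:C * f s).
rewrite rnormZr ?invr_ge0 ?(ltW Me0)//.
by rewrite ler_pdivrMl// mulr1 (le_trans (fM s))// lerDl ltW.
Qed.

(* The mean lies in every disc containing the range of f; the discs
   through 0 and M, centred at M / 2 + i t, intersect in the segment [0, M]. *)
Lemma mean_ge0 f (M : R) :
  (forall s, rnorm (f s) <= M) -> (forall s, 0 <= f s) -> 0 <= mean f.
Proof.
move=> fM f0; have fb := bounded_complexP fM.
have M0 : 0 <= M by exact: le_trans (rnorm_ge0 _) (fM s0).
have rE (z : R[i]) : rnorm z = Num.sqrt (complex.Re z ^+ 2 + complex.Im z ^+ 2).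
  by rewrite /rnorm normc_def.
have disc t : (complex.Re (mean f) - M / 2) ^+ 2 + (complex.Im (mean f) - t) ^+ 2
    <= (M / 2) ^+ 2 + t ^+ 2.
  pose w := Complex (M / 2) t.
  have wb : (fun=> w) \in @bounded_complex R S.
    exact: (@bounded_complexP _ (rnorm w)).
  have : rnorm (mean (fun s => (- 1) * w + f s)) <=
      Num.sqrt ((M / 2) ^+ 2 + t ^+ 2).
    apply: rnorm_mean => s; have := fM s; have := f0 s; rewrite lecE !rE.
    case: (f s) => a b /= /andP[/eqP -> a0]; rewrite expr0n addr0 => aM.
    rewrite ler_wsqrtr// !(mul0r, mulN1r, mul1r, oppr0, subr0, addr0, sqrrN) lerD2r.
    move: aM; rewrite sqrtr_sqr ger0_norm// => aM.
    nra.
  rewrite meanP// mean_cst rE mulN1r /= ler_sqrt ?addr_ge0 ?sqr_ge0//.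
  by rewrite [- w + _]addrC !raddfB.
have b0 : complex.Im (mean f) = 0.
  apply/eqP; apply/negP => /negP b0.
  (* In [disc t] the squares of [t] cancel, leaving a term linear in [t] whose coefficient is
     nonzero; this [t] makes the inequality fail by at least 1. *)
  have := disc (- ((M / 2) ^+ 2 + 1) / (2 * complex.Im (mean f))).
  set t := - _ / _.
  have : 2 * (complex.Im (mean f) * t) = - ((M / 2) ^+ 2 + 1).
    by rewrite /t; field.
  have := sqr_ge0 (complex.Re (mean f) - M / 2).
  have := sqr_ge0 (complex.Im (mean f)).
  clearbody t; lra.
rewrite lecE /= b0 eqxx /=.
have := disc 0; rewrite b0 subr0 expr0n !addr0.
move: (complex.Re (mean f)) => a h; rewrite leNgt; apply/negP => a0.
nra.
Qed.

End Mean.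

(** * The averaged operator and its properties *)

Section Average.
Local Open Scope complex_scope.
Variables (R : realType) (S : topMonoidType) (H : hilbertType R).
Variables (rho : S -> bop H) (mu : {scalar bfun R S}).
Hypothesis mu_opnorm : opnorm (@supnorm R S) (@rnorm R R[i]) mu = 1.
Hypothesis mu_one : mu (bfun_one R S) = 1.
Hypothesis mu_inv : forall t f, mu (ltranslate t f) = mu f.
Hypothesis rho_mul : forall s t : S, rho (s * t)%g = rho s * rho t.
Hypothesis rho_contractive : forall s : S, bopnorm (rho s) <= 1.
Implicit Types (A B D : bop H) (x y : H).

Definition coef D x y (s : S) : R[i] :=
  dotp ((rho s * D * adj (rho s)) x) y.

Lemma coefE D x y s : coef D x y s = dotp (D (adj (rho s) x)) (adj (rho s) y).
Proof. by rewrite -adjP. Qed.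

Lemma rnorm_coef D x y s :
  rnorm (coef D x y s) <= bopnorm D * rnorm x * rnorm y.
Proof.
rewrite coefE (le_trans (rnorm_dotp _ _))// ler_pM ?rnorm_ge0//; last first.
  exact: adj_contractive.
rewrite (le_trans (bopnorm_bound _ _))// ler_wpM2l ?bopnorm_ge0//.
exact: adj_contractive.
Qed.

Lemma coef_bounded D x y : coef D x y \in @bounded_complex R S.
Proof. exact: bounded_complexP (rnorm_coef D x y). Qed.

Lemma mean_translate t f : f \in @bounded_complex R S ->
  mean mu (fun s => f (t * s)%g) = mean mu f.
Proof.
move=> fb; rewrite /mean -[RHS](mu_inv t); congr (mu _); apply: val_inj.
rewrite insubdK; first by rewrite /= insubdK.
by rewrite -[f](insubdK (0 : bfun R S) fb) ltranslate_subproof.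
Qed.

Lemma average_exists :
  {P : bop H -> bop H & forall D x y, dotp (P D x) y = mean mu (coef D x y)}.
Proof.
apply: (@choice _ _ (fun D B => forall x y, dotp (B x) y = mean mu (coef D x y))).
move=> D; apply: (@bop_of_form _ _ _ (bopnorm D)).
- move=> a x x' y; rewrite -meanP ?coef_bounded//; congr mean.
  by apply/funext => s; rewrite /coef linearP linearDl /= linearZl_LR.
- move=> a x y y'; rewrite -meanP ?coef_bounded//; congr mean.
  by apply/funext => s; rewrite /coef linearDr /= linearZr_LR.
- move=> x y; apply: rnorm_mean => //; first exact: 1%g.
  exact: rnorm_coef.
Qed.

Variable P : bop H -> bop H.
Hypothesis avgP : forall D x y, dotp (P D x) y = mean mu (coef D x y).

Lemma average_linear : linear P.
Proof.
move=> a D D'; apply: bop_dot_inj => x y.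
have -> : dotp ((a *: P D + P D') x) y = a * dotp (P D x) y + dotp (P D' x) y.
  by rewrite linearDl /= linearZl_LR.
rewrite !avgP -meanP ?coef_bounded//.
congr mean; apply/funext => s; rewrite !coefE.
by rewrite linearDl /= linearZl_LR.
Qed.

(** Since [adj (rho (t * s)%g) = adj (rho s) * adj (rho t)], conjugating by [rho t] turns the
    coefficient at [s] into the one at [(t * s)%g], a left translate with the same mean. *)
Lemma average_toeplitz D : toeplitz rho (P D).
Proof.
move=> t; apply: bop_dot_inj => x y.
rewrite -[LHS]/(dotp (rho t (P D (adj (rho t) x))) y) [LHS]adjP !avgP.
rewrite -(mean_translate t (coef_bounded D x y)); congr mean; apply/funext => s.
by rewrite !coefE rho_mul adjM.
Qed.

Lemma average_id D : toeplitz rho D -> P D = D.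
Proof.
move=> DT; apply: bop_dot_inj => x y; rewrite avgP -[RHS](mean_cst mu_one).
by congr mean; apply/funext => s; rewrite /coef DT.
Qed.

Lemma average_commutant D A B : commutant rho A -> commutant rho B ->
  P (A * D * adj B) = A * P D * adj B.
Proof.
move=> cA cB; apply: bop_dot_inj => x y.
rewrite -[RHS]/(dotp (A (P D (adj B x))) y) [RHS]adjP !avgP.
congr mean; apply/funext => s; rewrite /coef -adjP.
rewrite -[RHS]/(dotp ((A * (rho s * D * adj (rho s)) * adj B) x) y).
(* Commutation with [B] is used under the adjoint: it exchanges [adj B] and [adj (rho s)]. *)
by rewrite !mulrA cA -!mulrA -!adjM cB.
Qed.

Let Adj n s (x : 'cV[H]_n) : 'cV[H]_n := map_mx (adj (rho s)) x.

(** Finite sums pass through the mean, so the entrywise action of [P] is itself an average of the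
    form of [A]. Positivity and norm bounds of [A] thus apply for each [s]. *)
Lemma cvdot_average n (A : 'M[bop H]_n) (x y : 'cV[H]_n) :
  cvdot (mxact (map_mx P A) x) y =
  mean mu (fun s => cvdot (mxact A (Adj s x)) (Adj s y)).
Proof.
have -> : (fun s => cvdot (mxact A (Adj s x)) (Adj s y)) =
    fun s => \sum_i \sum_j coef (A i j) (x j 0) (y i 0) s.
  apply/funext => s; apply: eq_bigr => i _; rewrite !mxE linear_sumlz.
  by apply: eq_bigr => j _; rewrite coefE mxE.
rewrite mean_sum => [|i]; last first.
  rewrite (_ : (fun s => _) = \sum_j coef (A i j) (x j 0) (y i 0)); last first.
    by apply/funext => s; rewrite fct_sumE.
  by rewrite rpred_sum// => j _; exact: coef_bounded.
apply: eq_bigr => i _; rewrite mean_sum => [|j]; last exact: coef_bounded.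
rewrite !mxE linear_sumlz; apply: eq_bigr => j _.
by rewrite mxE; exact: avgP.
Qed.

Lemma cvnorm_Adj n s (x : 'cV[H]_n) : cvnorm (Adj s x) <= cvnorm x.
Proof.
rewrite !cvnormE ler_wsqrtr// ler_sum// => i _; rewrite mxE.
by rewrite ler_sqr ?nnegrE ?rnorm_ge0//; exact: adj_contractive.
Qed.

Lemma rnorm_cvdot_Adj n (A : 'M[bop H]_n) (x y : 'cV[H]_n) s :
  rnorm (cvdot (mxact A (Adj s x)) (Adj s y)) <=
  mxopnorm A * cvnorm x * cvnorm y.
Proof.
rewrite (le_trans (rnorm_cvdot _ _))// ler_pM ?cvnorm_ge0 ?cvnorm_Adj//.
rewrite (le_trans (mxopnorm_bound _ _))// ler_wpM2l ?mxopnorm_ge0//.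
exact: cvnorm_Adj.
Qed.

Lemma average_completely_positive : completely_positive P.
Proof.
move=> n A A0 x; rewrite cvdot_average.
by apply: (mean_ge0 (1%g : S) mu_opnorm mu_one (rnorm_cvdot_Adj A x x)) => s.
Qed.

Lemma average_completely_contractive : completely_contractive P.
Proof.
move=> n A; apply: ge_sup.
  exists (cvnorm (mxact (map_mx P A) 0)), 0 => //=.
  by rewrite cvnormE big1 ?sqrtr0// => i _; rewrite mxE /rnorm normr0 expr0n.
move=> _ [x /= x1 <-]; set y := mxact _ x.
have [->|y0] := eqVneq (cvnorm y) 0; first exact: mxopnorm_ge0.
have yp : 0 < cvnorm y by rewrite lt_neqAle eq_sym y0 cvnorm_ge0.
(* The form is tested against [y] itself: the square of [cvnorm y] is an average bounded by
   [mxopnorm A * cvnorm x * cvnorm y], and one factor [cvnorm y] cancels. *)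
rewrite -(ler_pM2r yp) -expr2.
have -> : cvnorm y ^+ 2 = rnorm (cvdot y y).
  by rewrite cvdotxx /rnorm ger0_norm// ler0c sqr_ge0.
rewrite {1}/y cvdot_average.
apply: (@le_trans _ _ (mxopnorm A * cvnorm x * cvnorm y)).
  by apply: (rnorm_mean (1%g : S) mu_opnorm) => s; exact: rnorm_cvdot_Adj.
by rewrite ler_wpM2r ?cvnorm_ge0// ler_piMr// mxopnorm_ge0.
Qed.

End Average.

Theorem corollary3p6 (R : realType) (S : topMonoidType) (H : hilbertType R)
    (rho : S -> bop H)
    (S_amenable : amenable R S)
    (rho_continuous : opnorm_continuous rho)
    (rho_mul : forall s t : S, rho (s * t)%g = rho s * rho t)
    (rho_one : rho 1%g = 1)
    (rho_contractive : forall s : S, bopnorm (rho s) <= 1) :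
  exists P : {linear bop H -> bop H},
    [/\ completely_positive P,
        completely_contractive P,
        range P = toeplitz rho,
        P \o P = P
      & forall D A B : bop H, commutant rho A -> commutant rho B ->
          P (A * D * adj B) = A * P D * adj B].
Proof.
have [mu [mu_opnorm mu_one mu_inv]] := S_amenable.
have [avg avgP] := average_exists mu_opnorm rho_contractive.
have avg_lin := average_linear rho_contractive avgP.
have avgT := average_toeplitz mu_inv rho_mul rho_contractive avgP.
have avgI := average_id mu_one avgP.
have avg_cp :=
  average_completely_positive mu_opnorm mu_one rho_contractive avgP.
have avg_cc :=
  average_completely_contractive mu_opnorm rho_contractive avgP.
pose P : {linear bop H -> bop H} :=
  HB.pack avg (GRing.isLinear.Build R[i] (bop H) (bop H) *:%R avg avg_lin).
exists P; split.
- exact: avg_cp.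
- exact: avg_cc.
- apply/seteqP; split => [_ [D _ <-]|D DT]; first exact: avgT.
  by exists D; rewrite //= avgI.
(* Every average is Toeplitz, hence fixed by a second averaging. *)
- by apply/funext => D /=; rewrite avgI.
- exact: average_commutant avgP.
Qed.
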